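(* Consider on a single element $E$ the flux-differencing semi-discretization $$ \begin{aligned} \omega_i\omega_j J_{ij}\frac{\mathrm d}{\mathrm dt}\boldsymbol u_{ij} &= \omega_j\Big(-\sum_{m=0}^N S_{im}(J\boldsymbol f^1)^{\#}_{ij,mj}+\delta_{i0}(J\boldsymbol f^1)^{*}_{0j,0j^+}-\delta_{iN}(J\boldsymbol f^1)^{*}_{Nj,Nj^+}\Big)\\ &\quad+\omega_i\Big(-\sum_{m=0}^N S_{jm}(J\boldsymbol f^2)^{\#}_{ij,im}+\delta_{j0}(J\boldsymbol f^2)^{*}_{i0,i0^+}-\delta_{jN}(J\boldsymbol f^2)^{*}_{iN,iN^+}\Big)+\omega_i\omega_jJ_{ij}\boldsymbol s_{ij},\quad 0\le i,j\le N, \end{aligned} $$ with $\boldsymbol u_{ij}=(h_{ij},(hv^1)_{ij},(hv^2)_{ij})^{\mathrm T}$. Denote by $(Jhv^1)^{\#}_{L,R}$, $(Jhv^2)^{\#}_{L,R}$ and $(Jhv^1)^{*}_{L,R}$, $(Jhv^2)^{*}_{L,R}$ the first (mass) entries of the two-point volume fluxes $(J\boldsymbol f^1)^{\#}_{L,R}$, $(J\boldsymbol f^2)^{\#}_{L,R}$ and of the interface fluxes $(J\boldsymbol f^1)^{*}_{L,R}$, $(J\boldsymbol f^2)^{*}_{L,R}$, respectively. If $(Jhv^1)^{\#}_{L,R}$ and $(Jhv^2)^{\#}_{L,R}$ are symmetric with respect to $(\cdot)_L$ and $(\cdot)_R$, and the first entry of the source vector $\boldsymbol s$ is zero, then $$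 \frac{\mathrm d}{\mathrm dt}I_E[h]=\sum_{j=0}^N\omega_j\Big[(Jhv^1)^{*}_{0j,0j^+}-(Jhv^1)^{*}_{Nj,Nj^+}\Big]+\sum_{i=0}^N\omega_i\Big[(Jhv^2)^{*}_{i0,i0^+}-(Jhv^2)^{*}_{iN,iN^+}\Big]. $$
   Context: The element $E$ of a mesh of a surface $S\subset\mathbb R^3$ is the image of the reference square $D=[-1,1]^2$ (coordinates $\xi^1,\xi^2$) under a smooth, bijective, time-invariant mapping $\vec X$. With $\vec a_i=\partial_i\vec X$, the metric matrix is $\boldsymbol G=(G_{ij})$, $G_{ij}=\vec a_i\cdot\vec a_j$ (symmetric positive definite), and $J=\sqrt{\det\boldsymbol G}$. Let $\{\xi_i\}_{i=0}^N\subset[-1,1]$ be the Legendre--Gauss--Lobatto (LGL) nodes (including both endpoints) with positive weights $\{\omega_i\}_{i=0}^N$ and Lagrange polynomials $\ell_i$. A double subscript $(\cdot)_{ij}$ denotes a quantity at $(\xi_i,\xi_j)$. Matrices (zero-based indices): $D_{ij}=\ell_j'(\xi_i)$, $M_{ij}=\omega_i\delta_{ij}$, $\boldsymbol Q=\boldsymbol M\boldsymbol D$, $\boldsymbol B=\mathrm{diag}(-1,0,\dots,0,1)$, $\boldsymbol S=2\boldsymbol Q-\boldsymbol B$. These satisfy $\boldsymbol Q+\boldsymbol Q^{\mathrm T}=\boldsymbol B$ and $\sum_mD_{im}=0$ for all $i$. The volume fluxes $(J\boldsymbol f^k)^{\#}_{L,R}=(J\boldsymbol f^k)^{\#}((\boldsymbol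 u,\boldsymbol G,b)_L,(\boldsymbol u,\boldsymbol G,b)_R)$ and interface fluxes $(J\boldsymbol f^k)^{*}_{L,R}=(J\boldsymbol f^k)^{*}((\boldsymbol u,\boldsymbol G,b)_L,(\boldsymbol u,\boldsymbol G,b)_R)$, $k=1,2$, are $\mathbb R^3$-valued functions of a left and a right state (solution $\boldsymbol u$, metric $\boldsymbol G$, bottom topography $b$), not necessarily symmetric in their two arguments. For example $(J\boldsymbol f^1)^{\#}_{ij,mj}$ is evaluated with left state at node $(\xi_i,\xi_j)$ and right state at node $(\xi_m,\xi_j)$. Symmetry of the mass flux means $(Jhv^k)^{\#}_{L,R}=(Jhv^k)^{\#}_{R,L}$. A subscript with superscript ''$+$'' denotes the external state at the coincident node of the adjacent element, with momentum components transformed to the local coordinate system of the interior node. The discrete element integral is $I_E[h]=\sum_{i,j=0}^N\omega_i\omega_jJ_{ij}h_{ij}$. *)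

(* Defs.v *)
From HB Require Import structures.
From mathcomp Require Import all_boot all_order all_algebra.
From mathcomp Require Import all_classical all_reals all_analysis.

Set Implicit Arguments.
Unset Strict Implicit.
Unset Printing Implicit Defensive.

Import Order.TTheory GRing.Theory Num.Theory.
Import numFieldNormedType.Exports.

Local Open Scope classical_set_scope.
Local Open Scope ring_scope.

Section LegendreGaussLobatto.
Context {R : realType}.

(* Rodrigues' formula: P_n = (2^n n!)^-1 d^n/dx^n (x^2 - 1)^n *)
Definition legendre (n : nat) : {poly R} :=
  (2 ^+ n * (n`!)%:R)^-1 *: (('X^2 - 1) ^+ n)^`(n).

(* The endpoints -1 and 1 together with the N - 1 zeros of P_N' in (-1, 1),
   numbered increasingly; meaningful for N >= 1. *)
Definition LGL_nodes (N : nat) (xi : 'I_N.+1 -> R) : Prop :=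
  [/\ {homo xi : i j / (i < j)%N >-> i < j},
      xi ord0 = -1, xi ord_max = 1 &
      forall i, i != ord0 -> i != ord_max -> root (legendre N)^`() (xi i)].

Context {N : nat}.
Variable xi : 'I_N.+1 -> R.

(* [qpoly.lagrange] samples at an injective x : nat -> R, hence is not suited to
   a finite family of nodes. *)
Definition lagrange_basis (j : 'I_N.+1) : {poly R} :=
  \prod_(k < N.+1 | k != j) ((xi j - xi k)^-1 *: ('X - (xi k)%:P)).

Definition LGL_weight (i : 'I_N.+1) : R :=
  \int[lebesgue_measure]_(x in `[-1, 1]) (lagrange_basis i).[x].

Definition D_mx : 'M[R]_N.+1 := \matrix_(i, j) ((lagrange_basis j)^`()).[xi i].

Definition M_mx : 'M[R]_N.+1 := diag_mx (\row_i LGL_weight i).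

Definition Q_mx : 'M[R]_N.+1 := M_mx *m D_mx.

Definition B_mx : 'M[R]_N.+1 :=
  diag_mx (\row_i ((i == ord_max)%:R - (i == ord0)%:R)).

Definition S_mx : 'M[R]_N.+1 := 2 *: Q_mx - B_mx.

End LegendreGaussLobatto.

Section ElementGeometry.
Context {R : realType}.

Definition ref_square : set 'rV[R]_2 := [set p | forall k, -1 <= p 0 k <= 1].

Definition partial {m : nat} (k : 'I_2) (f : 'rV[R]_2 -> 'rV[R]_m) :
  'rV[R]_2 -> 'rV[R]_m := 'D_(delta_mx 0 k) f.

(* C^oo on a closed set: all iterated partial derivatives exist and are
   differentiable on an open neighbourhood. *)
Definition smooth_near {m : nat} (A : set 'rV[R]_2) (f : 'rV[R]_2 -> 'rV[R]_m) :
  Prop :=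
  exists U : set 'rV[R]_2, [/\ open U, A `<=` U &
    forall (ks : seq 'I_2) p, U p -> differentiable (foldr partial f ks) p].

Variable X : 'rV[R]_2 -> 'rV[R]_3.

Definition metric_mx (p : 'rV[R]_2) : 'M[R]_2 :=
  \matrix_(i, j) (partial i X p *m (partial j X p)^T) 0 0.

Definition area_elt (p : 'rV[R]_2) : R := Num.sqrt (\det (metric_mx p)).

Definition posdef_mx {n : nat} (A : 'M[R]_n) : Prop :=
  A^T = A /\ forall v : 'rV[R]_n, v != 0 -> 0 < (v *m A *m v^T) 0 0.

Definition element_map (E : set 'rV[R]_3) : Prop :=
  [/\ smooth_near ref_square X, set_bij ref_square E X &
      forall p, ref_square p -> posdef_mx (metric_mx p)].

Context {N : nat}.
Variable xi : 'I_N.+1 -> R.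

Definition node (i j : 'I_N.+1) : 'rV[R]_2 :=
  \row_k (if k == 0 then xi i else xi j).

Definition J_node (i j : 'I_N.+1) : R := area_elt (node i j).

Definition elt_integral (g : 'I_N.+1 -> 'I_N.+1 -> R) : R :=
  \sum_(i < N.+1) \sum_(j < N.+1)
    LGL_weight xi i * LGL_weight xi j * J_node i j * g i j.

End ElementGeometry.

(* The arguments (u, G, b) of the two-point fluxes, with u = (h, h v^1, h v^2). *)
Record state (R : realType) := State {
  st_u : 'rV[R]_3;
  st_metric : 'M[R]_2;
  st_bottom : R }.

Definition node_state {R : realType} {N : nat} (xi : 'I_N.+1 -> R)
    (X : 'rV[R]_2 -> 'rV[R]_3) (b : 'I_N.+1 -> 'I_N.+1 -> R)
    (v : 'I_N.+1 -> 'I_N.+1 -> 'rV[R]_3) (i j : 'I_N.+1) : state R :=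
  State (v i j) (metric_mx X (node xi i j)) (b i j).

(* The first entry of (h, h v^1, h v^2), of a flux or of a source vector. *)
Definition mass {R : realType} (v : 'rV[R]_3) : R := v 0 0.

(* States of the adjacent elements at the nodes of the four edges, momentum
   being expressed in the local coordinates of the interior node.  A corner node
   has two of them, one for each edge.  [ext_lo1 j] and [ext_hi1 j] are the
   states at 0j^+ and Nj^+, [ext_lo2 i] and [ext_hi2 i] those at i0^+ and iN^+. *)
Record ext_states (R : realType) (N : nat) := ExtStates {
  ext_lo1 : 'I_N.+1 -> state R;
  ext_hi1 : 'I_N.+1 -> state R;
  ext_lo2 : 'I_N.+1 -> state R;
  ext_hi2 : 'I_N.+1 -> state R }.

(* The flux-differencing semi-discretization at time t; [vol k] and [num k] are
   the volume flux (J f^(k+1))^# and the interface flux (J f^(k+1))^*. *)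
Definition semi_discretization {R : realType} {N : nat} (xi : 'I_N.+1 -> R)
    (X : 'rV[R]_2 -> 'rV[R]_3) (b : 'I_N.+1 -> 'I_N.+1 -> R)
    (vol num : 'I_2 -> state R -> state R -> 'rV[R]_3)
    (ext : R -> ext_states R N)
    (s u : R -> 'I_N.+1 -> 'I_N.+1 -> 'rV[R]_3) (t : R) : Prop :=
  let w := LGL_weight xi in
  let S := S_mx xi in
  let J := J_node X xi in
  let st := node_state xi X b (u t) in
  forall i j : 'I_N.+1,
    derivable (fun t' => u t' i j : 'rV[R]_3) t 1 /\
    (w i * w j * J i j) *: derive1 (fun t' => u t' i j : 'rV[R]_3) t =
      w j *: (- (\sum_(m < N.+1) S i m *: vol 0 (st i j) (st m j))
              + (i == ord0)%:R *: num 0 (st ord0 j) (ext_lo1 (ext t) j)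
              - (i == ord_max)%:R *: num 0 (st ord_max j) (ext_hi1 (ext t) j))
    + w i *: (- (\sum_(m < N.+1) S j m *: vol 1 (st i j) (st i m))
              + (j == ord0)%:R *: num 1 (st i ord0) (ext_lo2 (ext t) i)
              - (j == ord_max)%:R *: num 1 (st i ord_max) (ext_hi2 (ext t) i))
    + (w i * w j * J i j) *: s t i j.

(* Main.v *)
Require Import Defs.
From HB Require Import structures.
From mathcomp Require Import all_boot all_order all_algebra.
From mathcomp Require Import all_classical all_reals all_analysis.

Set Implicit Arguments.
Unset Strict Implicit.
Unset Printing Implicit Defensive.

Import Order.TTheory GRing.Theory Num.Theory.
Import numFieldNormedType.Exports.

Local Open Scope classical_set_scope.
Local Open Scope ring_scope.

(** Differentiating the element integral and inserting the scheme leaves, for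
    every grid line of the element, the sum over the line of the flux-differencing
    terms, weighted by the quadrature weight of the transverse index. The volume
    part of such a sum is the double sum of S_im F_im, where F is symmetric by the
    hypothesis on the mass fluxes. It vanishes once S is skew-symmetric
    ([sum_flux_differencing]), and what remains is the interface fluxes at the two
    ends of the line.

    As S = 2Q - B, skew-symmetry of S is the summation-by-parts property
    Q + Q^T = B ([LGL_sbp]). The matrices being built from the nodes and from the
    integrals of the Lagrange polynomials, it has to be derived: it says that the
    quadrature integrates the derivatives (l_i l_j)' exactly, so it rests on the
    exactness of the Legendre-Gauss-Lobatto rule up to degree 2N - 1 ([LGL_exact]).
    That follows from the orthogonality of P_N to polynomials of lower degree
    ([legendre_orth]) and from the fact that the node polynomial is a multiple of
    (X^2 - 1) P_N' ([node_poly_lobatto]).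

    All integrals of polynomials are reduced to end-point values by the fundamental
    theorem of calculus ([poly_integral_deriv]); the rest of the quadrature theory
    is then algebra in {poly R}. *)

(** * Integration of polynomials over [-1, 1] *)

Definition poly_integral {R : realType} (p : {poly R}) : R :=
  \int[lebesgue_measure]_(x in `[-1, 1]) p.[x].

Section PolyIntegral.
Context {R : realType}.
Implicit Types p q : {poly R}.

Lemma poly_integral_deriv p : poly_integral p^`() = p.[1] - p.[-1].
Proof.
rewrite /poly_integral /Rintegral (@continuous_FTC2 _ _ (horner p)) //.
- by apply/continuous_subspaceT => x; exact: continuous_horner.
- split=> [x _||]; first exact: derivable_horner.
  + by apply: cvg_at_right_filter; exact: continuous_horner.
  + by apply: cvg_at_left_filter; exact: continuous_horner.
- by move=> x _; rewrite derivE.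
Qed.

Lemma poly_primitive p : exists q, q^`() = p.
Proof.
exists (\poly_(i < (size p).+1) (p`_i.-1 / i%:R)).
apply/polyP => i; rewrite coef_deriv coef_poly ltnS /=.
case: ltnP => [_|ip]; last by rewrite mul0rn nth_default.
by rewrite -[LHS]mulr_natr divfK // pnatr_eq0.
Qed.

(** Through primitives, linearity is inherited from evaluation at the end points,
    without any integrability argument. *)
Lemma poly_integral_is_linear : linear_for *%R (@poly_integral R).
Proof.
move=> a p q.
have [P <-] := poly_primitive p; have [Q <-] := poly_primitive q.
rewrite -derivZ -derivD !poly_integral_deriv !hornerD !hornerZ.
by rewrite mulrBr opprD addrACA.
Qed.

HB.instance Definition _ := GRing.isLinear.Build R {poly R} R *%R
  (@poly_integral R) poly_integral_is_linear.

Lemma poly_integral_by_parts p q :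
  poly_integral (p * q^`()) =
  p.[1] * q.[1] - p.[-1] * q.[-1] - poly_integral (p^`() * q).
Proof.
rewrite -!hornerM -poly_integral_deriv -raddfB /=.
by rewrite derivM addrAC subrr add0r.
Qed.

End PolyIntegral.

(** * Legendre polynomials *)

(** Differentiation lowers the multiplicity of a factor by at most one. *)
Lemma dvdp_derivn_exp (R : fieldType) (g : {poly R}) n k :
  (k <= n)%N -> g ^+ (n - k) %| (g ^+ n)^`(k).
Proof.
elim: k => [|k IH] kn; first by rewrite subn0 derivn0.
rewrite derivnS; have /dvdpP[r ->] := IH (ltnW kn).
rewrite derivM deriv_exp -(subnSK kn) /= dvdp_add //.
  by rewrite dvdp_mull // dvdp_exp2l // leqnSn.
by rewrite dvdp_mull // -mulr_natl !dvdp_mull.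
Qed.

Section Legendre.
Context {R : realType}.
Implicit Types q : {poly R}.

(** Each integration by parts moves one derivative onto q, which drops out
    after k of them; the boundary terms vanish because a derivative of order
    less than n of (X^2 - 1)^n still has the factor X^2 - 1. *)
Lemma rodrigues_orth n k q :
  (k <= n)%N -> (size q <= k)%N ->
  poly_integral (q * (('X^2 - 1) ^+ n)^`(k)) = 0.
Proof.
elim: k q => [|k IH] q kn sq.
  by move: sq; rewrite leqn0 size_poly_eq0 => /eqP ->; rewrite mul0r raddf0.
have root_derivn (x : R) : x ^+ 2 = 1 -> (('X^2 - 1) ^+ n)^`(k).[x] = 0.
  move=> x1.
  have /dvdpP[r ->] := dvdp_derivn_exp ('X^2 - 1 : {poly R}) (ltnW kn).
  by rewrite !hornerE x1 subrr expr0n subn_eq0 leqNgt kn mulr0.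
rewrite derivnS poly_integral_by_parts !root_derivn ?expr1n ?sqrrN ?expr1n //.
rewrite IH ?(ltnW kn) ?mulr0 ?subrr //.
have [->|q0] := eqVneq q 0; first by rewrite deriv0 size_poly0.
by rewrite -ltnS (leq_trans (lt_size_deriv q0)).
Qed.

Lemma legendre_orth n q :
  (size q <= n)%N -> poly_integral (q * legendre n) = 0.
Proof.
by move=> sq; rewrite /legendre -scalerAr linearZ /= rodrigues_orth ?mulr0.
Qed.

(** The top coefficient of (X^2 - 1)^n, of degree 2n, survives n
    differentiations because the characteristic is 0. *)
Lemma size_legendre n : size (legendre n : {poly R}) = n.+1.
Proof.
have size_g : size ('X^2 - 1 : {poly R}) = 3 by rewrite size_Xn_sub_1.
have mon_g : ('X^2 - 1 : {poly R}) ^+ n \is monic.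
  by rewrite monic_exp // monic_Xn_sub_1.
have sz_gn : size (('X^2 - 1 : {poly R}) ^+ n) = (n + n).+1.
  rewrite -(prednK (n := size _)) ?size_poly_gt0 ?monic_neq0 //.
  by rewrite size_exp size_g mul2n addnn.
rewrite /legendre size_scale; last first.
  by rewrite invr_eq0 mulf_neq0 ?expf_neq0 ?pnatr_eq0 -?lt0n ?fact_gt0.
apply/eqP; rewrite eqn_leq; apply/andP; split.
  apply/leq_sizeP => j nj; rewrite coef_derivn nth_default ?mul0rn //.
  by rewrite sz_gn -addnS leq_add2l.
rewrite ltnNge; apply/negP => /leq_sizeP/(_ n (leqnn _)).
have /monicP := mon_g; rewrite lead_coefE sz_gn /= coef_derivn => -> /eqP.
by rewrite pnatr_eq0 eqn0Ngt ffact_gt0 leq_addr.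
Qed.

Lemma size_deriv_legendre n : size (legendre n : {poly R})^`() = n.
Proof.
apply/eqP; rewrite eqn_leq; apply/andP; split.
  rewrite -ltnS -(size_legendre n) lt_size_deriv //.
  by rewrite -size_poly_eq0 size_legendre.
case: n => // n; rewrite ltnNge; apply/negP => /leq_sizeP/(_ n (leqnn _)).
rewrite coef_deriv => /eqP; rewrite -mulr_natr mulf_eq0 pnatr_eq0 orbF.
have := size_legendre n.+1 => /(congr1 predn) /= sz.
by rewrite -[X in _`_X]sz -lead_coefE lead_coef_eq0 -size_poly_eq0 size_legendre.
Qed.

End Legendre.

(** * Exactness of the Legendre-Gauss-Lobatto quadrature *)

Lemma sum_kronecker (R : pzSemiRingType) (I : finType) (k : I) (f : I -> R) :
  \sum_i (i == k)%:R * f i = f k.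
Proof.
rewrite (bigD1 k) //= eqxx mul1r big1 ?addr0 // => i /negbTE ->.
by rewrite mul0r.
Qed.

Section Quadrature.
Context {R : realType} {N : nat}.
Variable xi : 'I_N.+1 -> R.
Hypothesis N0 : (0 < N)%N.
Hypothesis hxi : LGL_nodes xi.

Lemma LGL_nodes_inj : injective xi.
Proof.
have [mono _ _ _] := hxi.
move=> i j; case: (ltngtP i j) => [/mono|/mono|/val_inj //] ij e;
  by rewrite e ltxx in ij.
Qed.

Lemma uniq_nodes : uniq (codom xi).
Proof. by apply/injectiveP; exact: LGL_nodes_inj. Qed.

Lemma size_lagrange_basis j : (size (lagrange_basis xi j) <= N.+1)%N.
Proof.
rewrite /lagrange_basis scaler_prod.
apply: leq_trans (size_scale_leq _ _) _.
rewrite -big_filter size_prod_XsubC size_filter -sum1_count sum1_card.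
by rewrite (cardC1 j) card_ord.
Qed.

Lemma horner_lagrange_basis i j : (lagrange_basis xi j).[xi i] = (i == j)%:R.
Proof.
rewrite /lagrange_basis horner_prod; have [->|ij] := eqVneq i j.
  rewrite big1 // => k kj; rewrite !hornerE mulVf // subr_eq0.
  by rewrite (inj_eq LGL_nodes_inj) eq_sym.
by rewrite (bigD1 i) //= !hornerE subrr mulr0 mul0r.
Qed.

(** Both sides have degree N + 1 and vanish at the N + 1 distinct nodes. This is
    how the choice of the nodes as zeros of P_N' enters the quadrature. *)
Lemma node_poly_lobatto :
  exists c : R, \prod_(z <- codom xi) ('X - z%:P) =
    c *: (('X^2 - 1) * (legendre N)^`()).
Proof.
set p := ('X^2 - 1) * _.
have p_size : size p = N.+2.
  rewrite size_mul -?size_poly_eq0 ?size_Xn_sub_1 ?size_deriv_legendre //.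
  by rewrite -lt0n.
have p0 : p != 0 by rewrite -size_poly_eq0 p_size.
have [_ xi0 xiN xiroot] := hxi.
have proots : all (root p) (codom xi).
  apply/allP => _ /codomP[i ->]; rewrite rootM.
  have [->|i0] := eqVneq i ord0.
    by rewrite xi0 /root !hornerE sqrrN expr1n subrr eqxx.
  have [->|iN] := eqVneq i ord_max.
    by rewrite xiN /root !hornerE expr1n subrr eqxx.
  by rewrite xiroot ?orbT.
have E := all_roots_prod_XsubC _ proots.
rewrite uniq_rootsE size_codom card_ord p_size in E.
exists (lead_coef p)^-1.
rewrite [X in _ *: X]E ?uniq_nodes // scalerA mulVf ?lead_coef_eq0 //.
by rewrite scale1r.
Qed.

(** The quadrature is exact on the interpolant of p, so what matters is the
    remainder r. It vanishes at the nodes, hence is q (X^2 - 1) P_N' up to a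
    constant, with deg q <= N - 2. One integration by parts has no boundary term,
    thanks to X^2 - 1, and leaves P_N against the derivative of q (X^2 - 1), which
    has degree at most N - 1: that integral is zero by orthogonality. *)
Lemma LGL_exact (p : {poly R}) : (size p <= N + N)%N ->
  poly_integral p = \sum_(i < N.+1) LGL_weight xi i * p.[xi i].
Proof.
move=> sp.
pose r := p - \sum_(i < N.+1) p.[xi i] *: lagrange_basis xi i.
have r_roots : all (root r) (codom xi).
  apply/allP => _ /codomP[i ->]; rewrite /root /r hornerD hornerN horner_sum.
  rewrite (bigD1 i) //= big1 => [|k ki].
    by rewrite hornerZ horner_lagrange_basis eqxx mulr1 addr0 subrr.
  by rewrite hornerZ horner_lagrange_basis eq_sym (negbTE ki) mulr0.
have sr : (size r <= N + N)%N.
  rewrite (leq_trans (size_polyD _ _)) // geq_max sp size_polyN.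
  apply: leq_trans (size_sum _ _ _) _; apply/bigmax_leqP => i _.
  apply: leq_trans (size_scale_leq _ _) (leq_trans (size_lagrange_basis _) _).
  by rewrite -add1n leq_add2r.
have : poly_integral r = 0.
  have [q rE] : exists q, r = q * \prod_(z <- codom xi) ('X - z%:P).
    by apply: uniq_roots_prod_XsubC; rewrite ?uniq_rootsE ?uniq_nodes.
  have sq : (size q < N)%N.
    have [q0|q0] := eqVneq q 0; first by rewrite q0 size_poly0.
    move: sr; rewrite rE size_Mmonic ?monic_prod_XsubC //.
    rewrite size_prod_XsubC size_codom card_ord addnS /=.
    by rewrite addnS -addSn leq_add2r.
  have [c nodeE] := node_poly_lobatto.
  rewrite rE nodeE -scalerAr linearZ /= mulrA poly_integral_by_parts.
  have g0 (x : R) : x ^+ 2 = 1 -> (q * ('X^2 - 1)).[x] = 0.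
    by move=> x1; rewrite !hornerE x1 subrr mulr0.
  rewrite !g0 ?sqrrN ?expr1n // !mul0r subrr sub0r.
  rewrite legendre_orth ?oppr0 ?mulr0 //.
  have [q0|q0] := eqVneq q 0; first by rewrite q0 mul0r deriv0 size_poly0.
  have qg0 : q * ('X^2 - 1) != 0.
    by rewrite mulf_neq0 // -size_poly_eq0 size_Xn_sub_1.
  rewrite -ltnS (leq_trans (lt_size_deriv qg0)) //.
  by rewrite size_Mmonic ?monic_Xn_sub_1 // size_Xn_sub_1 // addn3 /=.
move=> /eqP; rewrite /r raddfB raddf_sum subr_eq0 /= => /eqP ->.
by apply: eq_bigr => i _; rewrite linearZ /= mulrC.
Qed.

(** Since the basis is nodal, the (i, j) entry of Q + Q^T is the quadrature of
    (l_i l_j)'. This polynomial has degree 2N - 1, the limit up to which the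
    quadrature is exact, and its integral is the difference of the values of
    l_i l_j at the two end nodes. *)
Lemma LGL_sbp : Q_mx xi + (Q_mx xi)^T = B_mx.
Proof.
have [_ xi0 xiN _] := hxi.
have Q_entry i j :
    Q_mx xi i j = LGL_weight xi i * (lagrange_basis xi j)^`().[xi i].
  by rewrite /Q_mx /M_mx mul_diag_mx !mxE.
apply/matrixP => i j; rewrite mxE [_^T i j]mxE !Q_entry.
pose l := lagrange_basis xi.
have sz : (size (l i * l j)^`() <= N + N)%N.
  have [->|l0] := eqVneq (l i * l j) 0; first by rewrite deriv0 size_poly0.
  rewrite -ltnS (leq_trans (lt_size_deriv l0)) //.
  rewrite (leq_trans (size_polyMleq _ _)) //.
  have := leq_add (size_lagrange_basis i) (size_lagrange_basis j).
  by rewrite addSn addnS -/l; case: addn.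
have := LGL_exact sz; rewrite poly_integral_deriv derivM.
under eq_bigr => m _ do
  rewrite hornerD !hornerM !horner_lagrange_basis mulrDr mulrA
    [_ * (m == j)%:R]mulrC [X in _ + X]mulrCA.
rewrite big_split /= !sum_kronecker addrC => <-.
rewrite -xi0 -xiN !hornerM !horner_lagrange_basis /B_mx !mxE.
have [->|ij] := eqVneq i j.
  by rewrite mulr1n -!natrM !mulnb !andbb ![_ == j]eq_sym.
have off k : (k == i)%:R * (k == j)%:R = 0 :> R.
  by case: (eqVneq k i) => [->|_]; rewrite ?(negbTE ij) ?mulr0 ?mul0r.
by rewrite mulr0n !off subrr.
Qed.

(** * Telescoping of the volume fluxes along a grid line *)

Lemma S_mx_antisym : (S_mx xi)^T = - S_mx xi.
Proof.
have QT : (Q_mx xi)^T = B_mx - Q_mx xi by rewrite -LGL_sbp addrAC subrr add0r.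
rewrite /S_mx linearB linearZ /= QT {2}/B_mx tr_diag_mx -/B_mx.
by rewrite scalerBr opprB addrAC !scaler_nat [B_mx *+ 2]mulr2n addrK.
Qed.

(** A symmetric two-point flux paired with the skew-symmetric S sums to its own
    opposite, so only the two interface terms survive. *)
Lemma sum_flux_differencing (F : 'I_N.+1 -> 'I_N.+1 -> R) (a b : R) :
  (forall i m, F i m = F m i) ->
  \sum_(i < N.+1) (- (\sum_(m < N.+1) S_mx xi i m * F i m)
     + (i == ord0)%:R * a - (i == ord_max)%:R * b) = a - b.
Proof.
move=> Fsym.
rewrite sumrB big_split /= !sum_kronecker sumrN.
suff -> : \sum_(i < N.+1) \sum_(m < N.+1) S_mx xi i m * F i m = 0.
  by rewrite oppr0 add0r.
set s := \sum_(i < _) _.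
suff : s = - s by move/eqP; rewrite -addr_eq0 -mulr2n mulrn_eq0 => /eqP.
rewrite {1}/s exchange_big -sumrN; apply: eq_bigr => i _.
rewrite -sumrN; apply: eq_bigr => m _.
by rewrite Fsym -mulNr -[in LHS](trmxK (S_mx xi)) S_mx_antisym !mxE.
Qed.

End Quadrature.

(** * Rate of change of the element integral *)

Lemma is_derive_mass {R : realType} (v : R -> 'rV[R]_3) (t : R) :
  derivable v t 1 ->
  is_derive t 1 (fun t' => mass (v t')) (mass (derive1 v t)).
Proof.
move=> dv; apply: DeriveDef; first exact: (derivable_mxP v t 1).1.
by rewrite /mass derive1E derive_mx // mxE.
Qed.

Lemma is_derive_elt_integral {R : realType} {N : nat} (xi : 'I_N.+1 -> R) X
    (g : R -> 'I_N.+1 -> 'I_N.+1 -> R) (dg : 'I_N.+1 -> 'I_N.+1 -> R) (t : R) :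
  (forall i j, is_derive t 1 (fun t' => g t' i j) (dg i j)) ->
  is_derive t 1 (fun t' => elt_integral X xi (g t')) (elt_integral X xi dg).
Proof.
move=> dgP.
(* The sum is rewritten as a sum of functions, the form for which sums have a
   derivation rule. *)
pose c i j := LGL_weight xi i * LGL_weight xi j * J_node X xi i j.
have -> : (fun t' => elt_integral X xi (g t')) =
    \sum_(i < N.+1) \sum_(j < N.+1) c i j \*: (fun t' => g t' i j).
  apply/funext => t'; rewrite /elt_integral fct_sumE; apply: eq_bigr => i _.
  by rewrite fct_sumE.
by apply: is_derive_sum => i; apply: is_derive_sum => j.
Qed.

Theorem theorem1 (R : realType) (N : nat) (hN : (0 < N)%N)
    (xi : 'I_N.+1 -> R) (hxi : LGL_nodes xi)
    (X : 'rV[R]_2 -> 'rV[R]_3) (E : set 'rV[R]_3) (hX : element_map X E)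
    (b : 'I_N.+1 -> 'I_N.+1 -> R)
    (vol num : 'I_2 -> state R -> state R -> 'rV[R]_3)
    (ext : R -> ext_states R N)
    (s u : R -> 'I_N.+1 -> 'I_N.+1 -> 'rV[R]_3) (T : set R)
    (hscheme : forall t, T t -> semi_discretization xi X b vol num ext s u t)
    (hsym : forall (k : 'I_2) (L L' : state R),
       mass (vol k L L') = mass (vol k L' L))
    (hs : forall t i j, T t -> mass (s t i j) = 0) :
  forall t, T t ->
    let w := LGL_weight xi in
    let st := node_state xi X b (u t) in
    is_derive t 1 (fun t' => elt_integral X xi (fun i j => mass (u t' i j)))
      (\sum_(j < N.+1) w j *
         (mass (num 0 (st ord0 j) (ext_lo1 (ext t) j))
          - mass (num 0 (st ord_max j) (ext_hi1 (ext t) j)))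
       + \sum_(i < N.+1) w i *
         (mass (num 1 (st i ord0) (ext_lo2 (ext t) i))
          - mass (num 1 (st i ord_max) (ext_hi2 (ext t) i)))).
Proof.
move=> t Tt w st.
apply: is_derive_eq.
  apply: is_derive_elt_integral => i j; apply: is_derive_mass.
  by have [] := hscheme t Tt i j.
pose flux1 i j :=
  - (\sum_(m < N.+1) S_mx xi i m * mass (vol 0 (st i j) (st m j)))
  + (i == ord0)%:R * mass (num 0 (st ord0 j) (ext_lo1 (ext t) j))
  - (i == ord_max)%:R * mass (num 0 (st ord_max j) (ext_hi1 (ext t) j)).
pose flux2 i j :=
  - (\sum_(m < N.+1) S_mx xi j m * mass (vol 1 (st i j) (st i m)))
  + (j == ord0)%:R * mass (num 1 (st i ord0) (ext_lo2 (ext t) i))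
  - (j == ord_max)%:R * mass (num 1 (st i ord_max) (ext_hi2 (ext t) i)).
have mass_scheme i j :
    w i * w j * J_node X xi i j * mass (derive1 (fun t' => u t' i j) t) =
    w j * flux1 i j + w i * flux2 i j.
  have [_ /(congr1 mass)] := hscheme t Tt i j.
  rewrite /mass !mxE !summxE => ->.
  rewrite -[s t i j 0 0]/(mass _) hs // mulr0 addr0.
  congr (_ * (- _ + _ - _) + _ * (- _ + _ - _)); apply: eq_bigr => m _;
    by rewrite mxE.
rewrite /elt_integral.
under eq_bigr do under eq_bigr do rewrite mass_scheme.
under eq_bigr do rewrite big_split /=.
rewrite big_split exchange_big /=.
congr (_ + _); apply: eq_bigr => k _.
  by rewrite -mulr_sumr sum_flux_differencing.
by rewrite -mulr_sumr sum_flux_differencing.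
Qed.
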